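(* Let $A$ be a weak QLS-algebra with subspace of generators $W\subset A$, let $V\subset W$ be a hyperplane complementary to $k\cdot e$, and let $B$, $d_1\colon B^1\to B^2$ and $h\in B^2$ be the graded algebra, linear map and element constructed from $(A,W,V)$ as described in the context. Then the map $d_1\colon B^1\to B^2$ can be extended to a derivation $d$ of degree $+1$ of the graded algebra $B$, and the triple $(B,d,h)$ is a CDG-algebra.
   Context: Conventions: $k$ is a fixed field; an algebra is an associative $k$-algebra with unit $e$; all graded and filtered algebras are locally finite-dimensional (so $W$ below is finite-dimensional). $[a,b]=ab-(-1)^{\tilde a\tilde b}ba$ is the supercommutator ($\tilde a$ = degree of $a$). A derivation $d$ of degree $+1$ satisfies $d(ab)=d(a)b+(-1)^{\tilde a}a\,d(b)$. Quadratic algebra: a graded algebra of the form $T(V)/(I)$ with $V$ in degree $1$ and $I\subset V\otimes V$; its quadratic dual is $T(V^* )/(I^\perp)$, where $I^\perp\subset V^*\otimes V^*$ is the annihilator of $I$ under the pairing $\langle\alpha\otimes\beta,v\otimes w\rangle=\alpha(v)\beta(w)$. Weak QLS-algebra: an algebra $A$ with a subspace $W\subset A$, $e\in W$, such that, for $V$ a hyperplane in $W$ complementary to $k\cdot e$, $T_n(V)\subset T(V)$ the subspace of elements of degree $\le n$, and $J=\ker(T(V)\to A)$: (1) $A$ is generated by $W$; (2) the two-sided ideal $J$ is generated by $J_2=J\cap T_2(V)$. (This does not depend on the choice of $V$.) The underlying quadratic algebra $A^{(0)}$ has generators $V\simeq W/k e$ and relations $I=J_2 \bmod T_1(V)\subset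 V\otimes V$. Construction: let $B=T(V^* )/(I^\perp)$ be the quadratic dual of $A^{(0)}$, with graded components $B^i$, so $B^1=V^*$, $B^2\simeq I^*$. Since $J_2\cap(k\oplus V)=0$, the subspace $J_2\subset k\oplus V\oplus V\otimes V$ is the graph of a linear map $I\to k\oplus V$, written $(-h,-\varphi)$ in the following sense: there are unique $h\in I^*\simeq B^2$ and $\varphi\colon I\to V$ such that $J_2=\{p+\varphi(p)+h(p): p\in I\}$; i.e. the relations of $A$ are $p+\varphi(p)+h(p)=0$, $p\in I$. Put $d_1=\varphi^*\colon B^1=V^*\to I^*=B^2$. CDG-algebra: a triple $(B,d,h)$ with $B$ a graded algebra ($B^i=0$ for $i<0$), $d$ a derivation of $B$ of degree $+1$, and $h\in B^2$, such that $d^2=[h,\cdot\,]$ and $d(h)=0$. *)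

(* Defs.v *)
From HB Require Import structures.
From mathcomp Require Import all_boot all_order all_algebra.
From mathcomp Require Import boolp.
From mathcomp Require Import finmap.
From mathcomp.multinomials Require Import monalg.
From mathcomp Require Import ring.

Set Implicit Arguments.
Unset Strict Implicit.
Unset Printing Implicit Defensive.

Import GRing.Theory.

Local Open Scope ring_scope.

Inductive ideal_gen (R : nzRingType) (P : R -> Prop) : R -> Prop :=
| ideal_gen0 : ideal_gen P 0
| ideal_genM a p b : P p -> ideal_gen P (a * p * b)
| ideal_genD x y : ideal_gen P x -> ideal_gen P y -> ideal_gen P (x + y).

Section Ideal.
Context (R : nzRingType) (P : R -> Prop).

Lemma ideal_genMl (a x : R) : ideal_gen P x -> ideal_gen P (a * x).
Proof.
elim=> {x} [|b p c Pp|x y _ IHx _ IHy]; first by rewrite mulr0; exact: ideal_gen0.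
  by rewrite !mulrA; exact: ideal_genM.
by rewrite mulrDr; exact: ideal_genD.
Qed.

Lemma ideal_genMr (a x : R) : ideal_gen P x -> ideal_gen P (x * a).
Proof.
elim=> {x} [|b p c Pp|x y _ IHx _ IHy]; first by rewrite mul0r; exact: ideal_gen0.
  by rewrite -!mulrA mulrA; exact: ideal_genM.
by rewrite mulrDl; exact: ideal_genD.
Qed.

Lemma ideal_genB (x y : R) :
  ideal_gen P x -> ideal_gen P y -> ideal_gen P (x - y).
Proof. by move=> Px Py; rewrite -mulN1r; exact/ideal_genD/ideal_genMl. Qed.

End Ideal.

Lemma scalerMM (k : fieldType) (A : algType k) (a b : k) (x y : A) :
  (a *: x) * (b *: y) = (a * b) *: (x * y).
Proof. by rewrite -scalerAl -scalerAr scalerA. Qed.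

(* The free algebra k<e_0, ..., e_(n-1)>, i.e. the monoid algebra of the free   *)
(* monoid {fmonom 'I_n} of words in n letters. Its product and scaling are    *)
(* those of the monoid algebra; they are locked for the sake of unification.  *)
Definition freealg (k : fieldType) (n : nat) := {malg k[{fmonom 'I_n}]}.

HB.lock Definition freealg_scale (k : fieldType) (n : nat) (c : k) (x : freealg k n) : freealg k n :=
  c *: x.
HB.lock Definition freealg_one (k : fieldType) (n : nat) : freealg k n := 1.
HB.lock Definition freealg_mul (k : fieldType) (n : nat) (x y : freealg k n) : freealg k n := x * y.
(* The word e_(s_0) e_(s_1) ..., and the coefficient of a word. *)
HB.lock Definition fword (k : fieldType) (n : nat) (s : seq 'I_n) : freealg k n :=
  << FMonom s >>.
HB.lock Definition fcoef (k : fieldType) (n : nat) (s : seq 'I_n) (x : freealg k n) : k :=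
  x@_(FMonom s).

Arguments fword {k n} s.

Section FreeAlgebra.
Context {k : fieldType} {n : nat}.
Local Notation FA := (freealg k n).
Implicit Types (x y z : FA) (s : seq 'I_n).

HB.instance Definition _ := GRing.Zmodule.on FA.

Let scale := @freealg_scale k n.
Let mul := @freealg_mul k n.
Let one := @freealg_one k n.

Fact freealg_scaleA a b x : scale a (scale b x) = scale (a * b) x.
Proof. by rewrite /scale unlock; exact: scalerA. Qed.

Fact freealg_scale1 : left_id 1 scale.
Proof. by move=> x; rewrite /scale unlock; exact: scale1r. Qed.

Fact freealg_scaleDr : right_distributive scale +%R.
Proof. by move=> c x y; rewrite /scale unlock; exact: scalerDr. Qed.

Fact freealg_scaleDl x : {morph scale^~ x : a b / a + b}.
Proof. by move=> a b; rewrite /scale unlock; exact: scalerDl. Qed.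

Fact freealg_mulA : associative mul.
Proof. by move=> x y z; rewrite /mul unlock; exact: mulrA. Qed.

Fact freealg_mul1l : left_id one mul.
Proof. by move=> x; rewrite /mul /one !unlock; exact: mul1r. Qed.

Fact freealg_mul1r : right_id one mul.
Proof. by move=> x; rewrite /mul /one !unlock; exact: mulr1. Qed.

Fact freealg_mulDl : left_distributive mul +%R.
Proof. by move=> x y z; rewrite /mul unlock; exact: mulrDl. Qed.

Fact freealg_mulDr : right_distributive mul +%R.
Proof. by move=> x y z; rewrite /mul unlock; exact: mulrDr. Qed.

Fact freealg_one_neq0 : one != 0.
Proof. by rewrite /one unlock; exact: oner_neq0. Qed.

Fact freealg_scaleAl c x y : scale c (mul x y) = mul (scale c x) y.
Proof. by rewrite /scale /mul !unlock; exact: scalerAl. Qed.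

Fact freealg_scaleAr c x y : scale c (mul x y) = mul x (scale c y).
Proof.
have xC : scale c x = mul x c%:MP.
  rewrite /scale /mul !unlock malgZ_def /fgscale malgM_def fgmulgU.
  by apply: eq_bigr => m _; rewrite mulm1 mulrC.
have yC : mul c%:MP y = scale c y.
  by rewrite /scale /mul !unlock; exact: mul_malgC.
by rewrite freealg_scaleAl xC -freealg_mulA yC.
Qed.

HB.instance Definition _ := GRing.Zmodule_isLmodule.Build k FA
  freealg_scaleA freealg_scale1 freealg_scaleDr freealg_scaleDl.
HB.instance Definition _ := GRing.Zmodule_isNzRing.Build FA
  freealg_mulA freealg_mul1l freealg_mul1r freealg_mulDl freealg_mulDr
  freealg_one_neq0.
HB.instance Definition _ :=
  GRing.Lmodule_isLalgebra.Build k FA freealg_scaleAl.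
HB.instance Definition _ :=
  GRing.Lalgebra_isAlgebra.Build k FA freealg_scaleAr.

Lemma fword0 : fword [::] = 1 :> FA.
Proof. by rewrite -[1]/one /one !unlock -fmoneE. Qed.

Lemma fword_cat s1 s2 : fword (s1 ++ s2) = fword s1 * fword s2 :> FA.
Proof.
rewrite -[_ * _]/(mul _ _) /mul !unlock [RHS]fgmulUU mulr1.
by congr mkmalgU; rewrite [RHS]fmmulE.
Qed.

(* The words with nonzero coefficient in x, without repetition. *)
Definition fsupp x : seq (seq 'I_n) :=
  [seq (m : seq _) | m : {fmonom _} <- msupp x].

Lemma fsupp_uniq x : uniq (fsupp x).
Proof. by rewrite map_inj_uniq ?fset_uniq //; exact: val_inj. Qed.

Lemma mem_fsupp x s : (s \in fsupp x) = (fcoef s x != 0).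
Proof.
rewrite unlock mcoeff_neq0; apply/mapP/idP => [[m mx ->]|]; first by rewrite fmK.
by exists (FMonom s).
Qed.

Lemma freealgP x y : (forall s, fcoef s x = fcoef s y) <-> x = y.
Proof.
rewrite -malgP unlock.
by split=> xy => [[s]|s]; apply: xy.
Qed.

Fact fcoef_is_scalar s : scalar (@fcoef k n s).
Proof.
move=> c x y; rewrite unlock [LHS]mcoeffD; congr (_ + _).
by rewrite -[c *: x]/(scale c x) /scale unlock; exact: mcoeffZ.
Qed.

HB.instance Definition _ s :=
  GRing.isLinear.Build k FA k *%R (@fcoef k n s) (fcoef_is_scalar s).

Lemma fcoefZ s c x : fcoef s (c *: x) = c * fcoef s x.
Proof. exact: linearZ. Qed.

Lemma fcoef_word s s' : fcoef s (fword s' : FA) = (s' == s)%:R.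
Proof. by rewrite !unlock mcoeffU -val_eqE. Qed.

Lemma fcoef0M x y : fcoef [::] (x * y) = fcoef [::] x * fcoef [::] y.
Proof.
rewrite -[x * y]/(mul _ _) /mul !unlock -fmoneE.
exact: (mcoeff1g_is_multiplicative _ _).1.
Qed.

Lemma freealgE x : x = \sum_(s <- fsupp x) fcoef s x *: fword s.
Proof.
apply/freealgP => s; rewrite linear_sum /=.
under eq_bigr do rewrite fcoefZ fcoef_word.
case: (boolP (s \in fsupp x)) => [sx|].
  rewrite (bigD1_seq s) ?fsupp_uniq //= eqxx mulr1 big1 ?addr0 // => i /negPf->.
  by rewrite mulr0.
move=> sx; rewrite big_seq big1 => [|i ix].
  by apply/eqP; rewrite mem_fsupp negbK in sx.
case: eqP => [is_|_]; last by rewrite mulr0.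
by rewrite -is_ ix in sx.
Qed.

(* Elements of degree n, resp. <= n (0 included). *)
Definition fdegree (d : nat) : {pred FA} :=
  fun x => all (fun s => size s == d) (fsupp x).

Definition fdegree_le (d : nat) : {pred FA} :=
  fun x => all (fun s => size s <= d)%N (fsupp x).

(* The algebra morphism k<e_0, ..., e_(n-1)> -> A mapping e_i to a i. *)
Definition feval (A : algType k) (a : 'I_n -> A) x : A :=
  \sum_(s <- fsupp x) fcoef s x *: \prod_(i <- s) a i.

Section Eval.
Context (A : algType k) (a : 'I_n -> A).

Lemma fevalEw r x : uniq r -> {subset fsupp x <= r} ->
  feval a x = \sum_(s <- r) fcoef s x *: \prod_(i <- s) a i.
Proof.
move=> r_uniq xr; rewrite /feval [RHS](bigID (mem (fsupp x))) /=.
rewrite [X in _ + X]big1 ?addr0; last first.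
  by move=> s; rewrite mem_fsupp negbK => /eqP->; rewrite scale0r.
rewrite -[RHS]big_filter; apply: perm_big; apply: uniq_perm.
- exact: fsupp_uniq.
- exact: filter_uniq.
by move=> s; rewrite mem_filter; case: (boolP (s \in fsupp x)) => // /xr ->.
Qed.

Fact feval_is_linear : linear (feval a).
Proof.
move=> c x y; pose r := undup (fsupp x ++ fsupp y ++ fsupp (c *: x + y)).
have sub z : z \in [:: x; y; c *: x + y] -> {subset fsupp z <= r}.
  by rewrite !inE => /or3P[] /eqP-> s zs; rewrite mem_undup !mem_cat zs ?orbT.
rewrite !(@fevalEw r) ?undup_uniq //; try by apply: sub; rewrite !inE eqxx ?orbT.
rewrite scaler_sumr -big_split /=; apply: eq_bigr => s _.
by rewrite linearP scalerDl scalerA.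
Qed.

HB.instance Definition _ :=
  GRing.isLinear.Build k FA A *:%R (feval a) feval_is_linear.

Lemma fevalZ c x : feval a (c *: x) = c *: feval a x.
Proof. exact: linearZ. Qed.

Lemma feval_word s : feval a (fword s) = \prod_(i <- s) a i.
Proof.
rewrite (@fevalEw [:: s]) //; first by rewrite big_seq1 fcoef_word eqxx scale1r.
by move=> s'; rewrite mem_fsupp fcoef_word inE [s == _]eq_sym; case: (s' == s); rewrite /= ?eqxx.
Qed.

Fact feval_is_monoid_morphism : monoid_morphism (feval a).
Proof.
split=> [|x y]; first by rewrite -fword0 feval_word big_nil.
rewrite [x]freealgE mulr_suml !linear_sum mulr_suml; apply: eq_bigr => s _.
rewrite [y]freealgE mulr_sumr !linear_sum mulr_sumr; apply: eq_bigr => s' _ /=.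
by rewrite scalerMM -fword_cat !fevalZ !feval_word big_cat scalerMM.
Qed.

HB.instance Definition _ :=
  GRing.isMonoidMorphism.Build FA A (feval a) feval_is_monoid_morphism.

End Eval.
End FreeAlgebra.

Arguments fdegree {k n} d _.
Arguments fdegree_le {k n} d _.

(* T(U), in terms of the basis vbasis {:U}. *)
Notation tensor k U := (freealg k (\dim {:U})).

Section Tensor.
Context {k : fieldType}.
Implicit Type U : vectType k.

Definition tgen U (u : U) : tensor k U :=
  \sum_(i < \dim {:U}) coord (vbasis {:U}) i u *: fword [:: i].

(* The algebra morphism T(U) -> A extending f : U -> A. *)
Definition tlift U (A : algType k) (f : U -> A) : tensor k U -> A :=
  feval (fun i => f (vbasis {:U})`_i).

Definition dual U : vectType k := 'Hom(U, k^o).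

(* The pairing of U^* (x) U^* with U (x) U; see pairing_tgen. *)
Definition pairing U (beta : tensor k (dual U)) (p : tensor k U) : k :=
  \sum_(a < \dim {:dual U}) \sum_(b < \dim {:dual U})
  \sum_(i < \dim {:U}) \sum_(j < \dim {:U})
    fcoef [:: a; b] beta * fcoef [:: i; j] p
    * ((vbasis {:dual U})`_a (vbasis {:U})`_i
       * (vbasis {:dual U})`_b (vbasis {:U})`_j).

Fact tgen_is_linear U : linear (@tgen U).
Proof.
move=> c u v; rewrite /tgen scaler_sumr -big_split; apply: eq_bigr => i _ /=.
by rewrite linearP scalerDl scalerA.
Qed.

HB.instance Definition _ U :=
  GRing.isLinear.Build k U (tensor k U) *:%R (@tgen U) (@tgen_is_linear U).

HB.instance Definition _ U (A : algType k) (f : U -> A) :=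
  GRing.LRMorphism.on (tlift f).

Lemma tlift_gen U (A : algType k) (f : {linear U -> A}) (u : U) :
  tlift f (tgen u) = f u.
Proof.
rewrite [in RHS](coord_vbasis (memvf u)) !linear_sum; apply: eq_bigr => i _ /=.
by rewrite /tlift fevalZ feval_word big_seq1 linearZ.
Qed.

Lemma tgenM U (u v : U) : tgen u * tgen v =
  \sum_(i < \dim {:U}) \sum_(j < \dim {:U})
    (coord (vbasis {:U}) i u * coord (vbasis {:U}) j v) *: fword [:: i; j].
Proof.
rewrite mulr_suml; apply: eq_bigr => i _; rewrite mulr_sumr.
by apply: eq_bigr => j _; rewrite scalerMM -fword_cat.
Qed.

Lemma fcoef_tgenM U (u v : U) i j :
  fcoef [:: i; j] (tgen u * tgen v)
    = coord (vbasis {:U}) i u * coord (vbasis {:U}) j v.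
Proof.
rewrite tgenM linear_sum (bigD1 i) //= linear_sum (bigD1 j) //=.
rewrite fcoefZ fcoef_word eqxx mulr1 !big1 ?addr0 // => [a ai|b bj].
  rewrite linear_sum big1 //= => b _.
  by rewrite fcoefZ fcoef_word !eqseq_cons (negPf ai) mulr0.
by rewrite fcoefZ fcoef_word !eqseq_cons (negPf bj) andbF mulr0.
Qed.

Lemma pairing_tgen U (alpha beta : dual U) (v w : U) :
  pairing (tgen alpha * tgen beta) (tgen v * tgen w) = alpha v * beta w.
Proof.
have dualE (al : dual U) (u : U) : al u =
  \sum_(a < \dim {:dual U}) \sum_(i < \dim {:U})
     coord (vbasis {:dual U}) a al * coord (vbasis {:U}) i u
       * (vbasis {:dual U})`_a (vbasis {:U})`_i.
  rewrite {1}(coord_vbasis (memvf al)) sum_lfunE; apply: eq_bigr => a _.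
  rewrite scale_lfunE {1}(coord_vbasis (memvf u)) linear_sum /= scaler_sumr.
  by apply: eq_bigr => i _; rewrite linearZ /= /GRing.scale /= mulrA.
rewrite /pairing !dualE [RHS]mulr_suml; apply: eq_bigr => a _.
rewrite [RHS]mulr_sumr; apply: eq_bigr => b _.
rewrite [RHS]mulr_suml; apply: eq_bigr => i _.
rewrite [RHS]mulr_sumr; apply: eq_bigr => j _.
by rewrite !fcoef_tgenM; ring.
Qed.

Fact pairing_is_scalar U (beta : tensor k (dual U)) : scalar (pairing beta).
Proof.
move=> c x y; rewrite /pairing mulr_sumr -big_split; apply: eq_bigr => a _ /=.
rewrite mulr_sumr -big_split; apply: eq_bigr => b _ /=.
rewrite mulr_sumr -big_split; apply: eq_bigr => i _ /=.
rewrite mulr_sumr -big_split; apply: eq_bigr => j _ /=.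
by rewrite linearP /=; ring.
Qed.

HB.instance Definition _ U (beta : tensor k (dual U)) :=
  GRing.isLinear.Build k (tensor k U) k *%R (pairing beta)
    (pairing_is_scalar beta).

End Tensor.

Section QuadraticAlgebra.
Context {k : fieldType} {U : vectType k}.
Variable S : {pred tensor k U}.

(* Only the part of S in U (x) U is used as relations: S is always a subspace *)
(* of U (x) U below, and the quotient is a nonzero algebra for every S.      *)
Definition qrels (s : tensor k U) : Prop := s \in S /\ s \in (fdegree 2 : {pred tensor k U}).

Definition qideal : {pred tensor k U} := fun x => `[< ideal_gen qrels x >].

Lemma qidealP x : reflect (ideal_gen qrels x) (x \in qideal).
Proof. exact: asboolP. Qed.

Fact qideal_zmod_closed : zmod_closed qideal.
Proof.
split=> [|x y /qidealP xI /qidealP yI]; apply/qidealP; first exact: ideal_gen0.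
exact: ideal_genB.
Qed.

HB.instance Definition _ :=
  GRing.isZmodClosed.Build (tensor k U) qideal qideal_zmod_closed.

Lemma qideal1 : 1 \notin qideal.
Proof.
suff H (y : tensor k U) : ideal_gen qrels y -> fcoef [::] y = 0.
  apply/qidealP => /H/eqP.
  by rewrite -fword0 fcoef_word eqxx oner_eq0.
elim=> {y} [|a p b [_ p2]|y z _ IHy _ IHz]; first exact: raddf0.
  rewrite !fcoef0M; suff -> : fcoef [::] p = 0 by rewrite mulr0 mul0r.
  apply: contraTeq p2 => p0; apply/allPn; exists [::] => //.
  by rewrite mem_fsupp.
by rewrite raddfD /= IHy IHz addr0.
Qed.

(* T(U)/(S) *)
Definition qalg := Quotient.quot qideal.

HB.instance Definition _ := GRing.Zmodule.on qalg.

Definition qproj (x : tensor k U) : qalg := \pi_(Quotient.quot qideal)%qT x.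
Definition qrepr (b : qalg) : tensor k U := repr (b : Quotient.quot qideal).

Lemma qreprK : cancel qrepr qproj.
Proof. exact: reprK. Qed.

Lemma qproj_eq x y : (qproj x == qproj y) = (x - y \in qideal).
Proof. by rewrite Quotient.idealrBE. Qed.

Fact qproj_zmod_morphism : zmod_morphism qproj.
Proof. by move=> x y; rewrite /qproj !piE. Qed.

HB.instance Definition _ :=
  GRing.isZmodMorphism.Build (tensor k U) qalg qproj qproj_zmod_morphism.

Lemma qproj_eq0 x : (qproj x == 0) = (x \in qideal).
Proof. by rewrite -(raddf0 qproj) qproj_eq subr0. Qed.

Fact qalg_key : unit. Proof. by []. Qed.

Definition qone : qalg := qproj 1.
Definition qmul (a b : qalg) : qalg :=
  locked_with qalg_key (fun a b => qproj (qrepr a * qrepr b)) a b.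
Definition qscale (c : k) (a : qalg) : qalg :=
  locked_with qalg_key (fun c a => qproj (c *: qrepr a)) c a.

Lemma qreprP x : x - qrepr (qproj x) \in qideal.
Proof. by rewrite -qproj_eq qreprK. Qed.

Lemma qideal_mull a x : x \in qideal -> a * x \in qideal.
Proof. by move=> /qidealP xI; apply/qidealP; exact: ideal_genMl. Qed.

Lemma qideal_mulr a x : x \in qideal -> x * a \in qideal.
Proof. by move=> /qidealP xI; apply/qidealP; exact: ideal_genMr. Qed.

Lemma qproj_mul x y : qproj (x * y) = qmul (qproj x) (qproj y).
Proof.
rewrite /qmul unlock; apply/eqP; rewrite qproj_eq.
rewrite -(subrKA (x * qrepr (qproj y))) -mulrBr -mulrBl rpredD //.
  exact/qideal_mull/qreprP.
exact/qideal_mulr/qreprP.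
Qed.

Lemma qproj_scale c x : qproj (c *: x) = qscale c (qproj x).
Proof.
rewrite /qscale unlock; apply/eqP.
by rewrite qproj_eq -scalerBr -mulr_algl; apply/qideal_mull/qreprP.
Qed.

Lemma qprojP (b : qalg) : exists x, b = qproj x.
Proof. by exists (qrepr b); rewrite qreprK. Qed.

Fact qmulA : associative qmul.
Proof.
move=> a b c; have [x ->] := qprojP a; have [y ->] := qprojP b.
by have [z ->] := qprojP c; rewrite -!qproj_mul mulrA.
Qed.

Fact qmul1l : left_id qone qmul.
Proof. by move=> a; have [x ->] := qprojP a; rewrite -qproj_mul mul1r. Qed.

Fact qmul1r : right_id qone qmul.
Proof. by move=> a; have [x ->] := qprojP a; rewrite -qproj_mul mulr1. Qed.

Fact qmulDl : left_distributive qmul +%R.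
Proof.
move=> a b c; have [x ->] := qprojP a; have [y ->] := qprojP b.
by have [z ->] := qprojP c; rewrite -raddfD -!qproj_mul mulrDl raddfD.
Qed.

Fact qmulDr : right_distributive qmul +%R.
Proof.
move=> a b c; have [x ->] := qprojP a; have [y ->] := qprojP b.
by have [z ->] := qprojP c; rewrite -raddfD -!qproj_mul mulrDr raddfD.
Qed.

Fact qone_neq0 : qone != 0.
Proof. by rewrite qproj_eq0 qideal1. Qed.

HB.instance Definition _ := GRing.Zmodule_isNzRing.Build qalg
  qmulA qmul1l qmul1r qmulDl qmulDr qone_neq0.

Fact qscaleA a b v : qscale a (qscale b v) = qscale (a * b) v.
Proof. by have [x ->] := qprojP v; rewrite -!qproj_scale scalerA. Qed.

Fact qscale1 : left_id 1 qscale.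
Proof. by move=> v; have [x ->] := qprojP v; rewrite -qproj_scale scale1r. Qed.

Fact qscaleDr : right_distributive qscale +%R.
Proof.
move=> a u v; have [x ->] := qprojP u; have [y ->] := qprojP v.
by rewrite -raddfD -!qproj_scale scalerDr raddfD.
Qed.

Fact qscaleDl v : {morph qscale^~ v : a b / a + b}.
Proof.
move=> a b; have [x ->] := qprojP v.
by rewrite -!qproj_scale scalerDl raddfD.
Qed.

HB.instance Definition _ := GRing.Zmodule_isLmodule.Build k qalg
  qscaleA qscale1 qscaleDr qscaleDl.

Fact qscaleAl (a : k) (u v : qalg) : a *: (u * v) = (a *: u) * v.
Proof.
have [x ->] := qprojP u; have [y ->] := qprojP v.
rewrite -[_ *: _]/(qscale _ _) -[_ *: _]/(qscale _ _) -![_ * _]/(qmul _ _).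
by rewrite -qproj_mul -!qproj_scale -qproj_mul scalerAl.
Qed.

HB.instance Definition _ := GRing.Lmodule_isLalgebra.Build k qalg qscaleAl.

Fact qscaleAr (a : k) (u v : qalg) : a *: (u * v) = u * (a *: v).
Proof.
have [x ->] := qprojP u; have [y ->] := qprojP v.
rewrite -[_ *: _]/(qscale _ _) -[_ *: _]/(qscale _ _) -![_ * _]/(qmul _ _).
by rewrite -qproj_mul -!qproj_scale -qproj_mul scalerAr.
Qed.

HB.instance Definition _ := GRing.Lalgebra_isAlgebra.Build k qalg qscaleAr.

Fact qproj_monoid_morphism : monoid_morphism qproj.
Proof. by split=> // x y; exact: qproj_mul. Qed.

HB.instance Definition _ :=
  GRing.isMonoidMorphism.Build (tensor k U) qalg qproj qproj_monoid_morphism.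

HB.instance Definition _ :=
  GRing.isScalable.Build k (tensor k U) qalg *:%R qproj qproj_scale.

(* The component of degree n of T(U)/(S). *)
Definition qgr (n : nat) : {pred qalg} :=
  fun b => `[< exists2 x, x \in fdegree n & b = qproj x >].

End QuadraticAlgebra.

Arguments qproj {k U} S x.
Arguments qgr {k U} S n _.

(* I^perp in U^* (x) U^*, for I in U (x) U. *)
Definition perp (k : fieldType) (U : vectType k) (S : {pred tensor k U}) :
    {pred tensor k (dual U)} := fun beta =>
  (beta \in fdegree 2) && `[< forall p, p \in S -> pairing beta p = 0 >].

(* Below f : U -> A is the inclusion in A of a finite-dimensional subspace.   *)
Section NonhomogeneousRelations.
Context {k : fieldType} {U : vectType k} {A : algType k}.
Variable f : {linear U -> A}.

(* J = ker(T(U) -> A) *)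
Definition relJ : {pred tensor k U} := fun x => tlift f x == 0.

(* J_2 = J n T_2(U) *)
Definition relJ2 : {pred tensor k U} :=
  fun x => (x \in fdegree_le 2) && (x \in relJ).

(* I = J_2 mod T_1(U), with (T_2(U) mod T_1(U)) identified with U (x) U.      *)
Definition relI : {pred tensor k U} := fun p =>
  (p \in fdegree 2) && `[< exists2 t, t \in fdegree_le 1 & p + t \in relJ2 >].

Lemma fdegree_submod d : submod_closed (fdegree d : {pred tensor k U}).
Proof.
split=> [|c x y /allP xd /allP yd]; apply/allP => s; rewrite mem_fsupp.
  by rewrite raddf0 eqxx.
rewrite linearP /= => xy0; case: (boolP (s \in fsupp x)) => [/xd //|].
rewrite mem_fsupp negbK => /eqP x0; apply: yd.
by rewrite mem_fsupp; apply: contraNneq xy0 => ->; rewrite x0 mulr0 addr0.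
Qed.

Lemma fdegree_le_submod d : submod_closed (fdegree_le d : {pred tensor k U}).
Proof.
split=> [|c x y /allP xd /allP yd]; apply/allP => s; rewrite mem_fsupp.
  by rewrite raddf0 eqxx.
rewrite linearP /= => xy0; case: (boolP (s \in fsupp x)) => [/xd //|].
rewrite mem_fsupp negbK => /eqP x0; apply: yd.
by rewrite mem_fsupp; apply: contraNneq xy0 => ->; rewrite x0 mulr0 addr0.
Qed.

Lemma relJ2_submod : submod_closed relJ2.
Proof.
have [T0 TP] := fdegree_le_submod 2.
split=> [|c x y /andP[xT xJ] /andP[yT yJ]]; apply/andP; split=> //.
- by apply/eqP; rewrite linear0.
- exact: TP.
apply/eqP; move/eqP: xJ => xJ; move/eqP: yJ => yJ.
by rewrite linearP /= xJ yJ scaler0 addr0.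
Qed.

Fact relI_submod : submod_closed relI.
Proof.
have [T0 TP] := fdegree_submod 2; have [T10 T1P] := fdegree_le_submod 1.
have [J0 JP] := relJ2_submod.
split=> [|c x y /andP[xT /asboolP[t tT xJ]] /andP[yT /asboolP[u uT yJ]]].
  by apply/andP; split=> //; apply/asboolP; exists 0; rewrite ?addr0.
apply/andP; split; first exact: TP.
apply/asboolP; exists (c *: t + u); first exact: T1P.
by rewrite addrACA -scalerDr; exact: JP.
Qed.

HB.instance Definition _ :=
  GRing.isSubmodClosed.Build k (tensor k U) relI relI_submod.

(* I as a vector space. *)
Record relI_space := RelI { relI_val :> tensor k U; _ : relI_val \in relI }.

HB.instance Definition _ := [isSub for relI_val].
HB.instance Definition _ := [Choice of relI_space by <:].
HB.instance Definition _ := [SubChoice_isSubLmodule of relI_space by <:].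

(* B = T(U^* )/(I^perp), the quadratic dual of A^(0) = T(U)/(I), and B^n.     *)
Definition dualB : algType k := qalg (perp relI).
Definition dualB_gr (n : nat) : {pred dualB} := qgr (perp relI) n.
Definition dualB_gen (alpha : dual U) : dualB := qproj (perp relI) (tgen alpha).

(* The isomorphism B^2 ~ I^*: b in B^2 corresponds to the functional g.       *)
Definition dualB2_rep (b : dualB) (g : relI_space -> k) : Prop :=
  exists beta : tensor k (dual U), [/\ beta \in fdegree 2,
    b = qproj (perp relI) beta & forall p, g p = pairing beta p].

End NonhomogeneousRelations.

Arguments relI_space {k U A} f.
Arguments dualB {k U A} f.
Arguments dualB_gr {k U A} f n _.
Arguments dualB_gen {k U A} f alpha.

(* (gr n)_n is a grading of B, with finite-dimensional components. *)
Record is_graded (k : fieldType) (B : algType k) (gr : nat -> {pred B}) : Prop :=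
  IsGraded {
    graded_submod n : submod_closed (gr n);
    graded_one : 1 \in gr 0;
    graded_mul m n x y : x \in gr m -> y \in gr n -> x * y \in gr (m + n)%N;
    graded_span b : exists n (c : 'I_n -> B),
      (forall i, c i \in gr i) /\ b = \sum_i c i;
    graded_free n (c : 'I_n -> B) :
      (forall i, c i \in gr i) -> \sum_i c i = 0 -> forall i, c i = 0;
    graded_findim n : exists m (s : 'I_m -> B),
      forall x, x \in gr n -> exists c : 'I_m -> k, x = \sum_i c i *: s i
  }.

(* d is a derivation of degree +1. *)
Record is_derivation1 (k : fieldType) (B : algType k) (gr : nat -> {pred B})
    (d : B -> B) : Prop := IsDerivation1 {
  derivation1_linear : linear d;
  derivation1_deg n x : x \in gr n -> d x \in gr n.+1;
  derivation1_mul n x y : x \in gr n ->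
    d (x * y) = d x * y + (-1) ^+ n * (x * d y)
}.

(* [a, b] for a, b of degrees i, j. *)
Definition supercomm (k : fieldType) (B : algType k) (i j : nat) (a b : B) : B :=
  a * b - (-1) ^+ (i * j) * (b * a).

Record is_CDG (k : fieldType) (B : algType k) (gr : nat -> {pred B})
    (d : B -> B) (h : B) : Prop := IsCDG {
  CDG_graded : is_graded gr;
  CDG_derivation : is_derivation1 gr d;
  CDG_curv_deg : h \in gr 2;
  CDG_curv n x : x \in gr n -> d (d x) = supercomm 2 n h x;
  CDG_bianchi : d h = 0
}.

(* The subspace W of A is given by an injective linear map j : W -> A from a  *)
(* finite-dimensional space, and e in W is the element with j e = 1.          *)
Definition hyperplane_compl (k : fieldType) (W : vectType k) (V : {vspace W})
    (e : W) : Prop :=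
  (V :&: <[e]> = 0)%VS /\ (V + <[e]> = fullv)%VS.

(* The inclusion in A of V in W. *)
Definition incl (k : fieldType) (A : algType k) (W : vectType k)
    (j : {linear W -> A}) (V : {vspace W}) : {linear subvs_of V -> A} :=
  j \o vsval.

Record weak_QLS (k : fieldType) (A : algType k) (W : vectType k)
    (j : {linear W -> A}) (e : W) : Prop := WeakQLS {
  weak_QLS_inj : injective j;
  weak_QLS_unit : j e = 1;
  weak_QLS_gen (S : {pred A}) :
    subalg_closed S -> (forall w, j w \in S) -> forall a, a \in S;
  weak_QLS_rel : exists2 V : {vspace W}, hyperplane_compl V e &
    forall x, x \in relJ (incl j V) <->
              ideal_gen (fun y => y \in relJ2 (incl j V)) x
}.

(* Main.v *)
Require Import Defs.
From HB Require Import structures.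
From mathcomp Require Import all_boot all_order all_algebra.
From mathcomp Require Import ssrAC boolp ring.

(* Write U for the space of generators, I for the quadratic relations and h, phi
   for the lower order terms. An element of I (x) U cap U (x) I, written as
   sum_c p_c e_c = sum_c e_c p'_c, gives two ways of rewriting the same cubic
   element in A; their difference
     r + sum_c (h(p_c) - h(p'_c)) e_c,
     r = sum_c (phi(p_c) e_c - e_c phi(p'_c)),
   is a relation of degree <= 2. Hence r is in I, phi(r) is the linear term and
   h(r) = 0. Extend d1 to a derivation D of T(U^* ): on tensors of degree 2, D is
   dual to q |-> r. Since the degree 3 part of the ideal of I^perp is the
   annihilator of I (x) U cap U (x) I, the three facts about r say respectively
   that D preserves that ideal, that D^2 = [h, .] on generators, and D h = 0. *)

Set Implicit Arguments.
Unset Strict Implicit.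
Unset Printing Implicit Defensive.

Import GRing.Theory.
Local Open Scope ring_scope.

(** * Double annihilators of subspaces of row vectors *)

Section Bipolar.
Context {k : fieldType} {N : nat}.

Lemma submod_closed_lincomb (V : lmodType k) (S : {pred V}) (I : Type)
    (r : seq I) (c : I -> k) (v : I -> V) :
  submod_closed S -> (forall i, v i \in S) -> \sum_(i <- r) c i *: v i \in S.
Proof.
move=> [S0 SP] Sv; elim: r => [|i r IHr]; first by rewrite big_nil.
by rewrite big_cons; exact: SP.
Qed.

(** Among the matrices with rows in [S] take one of maximal rank, which exists because ranks are at
    most [N]; a vector of [S] outside its row space would raise the rank. *)
Lemma submod_closed_rowspace (S : {pred 'rV[k]_N}) : submod_closed S ->
  exists M : 'M[k]_N, forall v, (v \in S) = (v <= M)%MS.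
Proof.
move=> Scl; pose P r := `[< exists2 M : 'M[k]_N, \rank M = r &
  forall i, row i M \in S >].
have sub_S m (M : 'M[k]_(m, N)) v :
    (forall i, row i M \in S) -> (v <= M)%MS -> v \in S.
  move=> MS /submxP[D ->]; rewrite mulmx_sum_row.
  exact: submod_closed_lincomb.
have exP : exists r, P r.
  exists 0; apply/asboolP; exists 0; first exact: mxrank0.
  by move=> i; rewrite row0; case: Scl.
have leP r : P r -> (r <= N)%N by move=> /asboolP[M <- _]; exact: rank_leq_row.
case: (ex_maxnP exP leP) => r /asboolP[M Mr MS] maxr.
exists M => v; apply/idP/idP => [vS|]; last exact: sub_S MS.
have Mv : (M <= col_mx M v)%MS by rewrite -addsmxE addsmxSl.
suff : (col_mx M v <= M)%MS by rewrite col_mx_sub => /andP[].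
rewrite -(mxrank_leqif_sup Mv) eqn_leq mxrankS // Mr; apply: maxr.
apply/asboolP; exists <<col_mx M v>>%MS; first exact: mxrank_gen.
move=> i; apply: (sub_S _ (col_mx M v)); last first.
  by apply: submx_trans (row_sub _ _) _; rewrite genmxE.
move=> l; rewrite -[l]splitK; case: (split l) => l' /=.
  by rewrite rowKu.
by rewrite rowKd row_id.
Qed.

(** The row space of [M] is the common kernel of the columns of [cokermx M]; each of these kills
    [S], hence [u]. *)
Lemma bipolar (S : {pred 'rV[k]_N}) (u : 'rV[k]_N) : submod_closed S ->
  (forall q : 'cV[k]_N, (forall v, v \in S -> v *m q = 0) -> u *m q = 0) ->
  u \in S.
Proof.
move=> Scl uS; have [M SM] := submod_closed_rowspace Scl.
rewrite SM submxE; apply/eqP/matrixP => i l.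
have : u *m col l (cokermx M) = 0.
  apply: uS => v; rewrite SM => /submxP[D ->].
  by rewrite colE -mulmxA (mulmxA M) mulmx_coker mul0mx mulmx0.
rewrite colE mulmxA -colE => /matrixP/(_ i 0).
by rewrite [LHS]mxE [RHS]mxE => ->; rewrite mxE.
Qed.

End Bipolar.

(** * Homogeneous components and the word form on the free algebra *)

Section FreeAlgebraExtra.
Context {k : fieldType} {n : nat}.
Local Notation FA := (freealg k n).
Implicit Types (x y z : FA) (s t : seq 'I_n) (L : FA -> Prop).

Lemma fdegree_ind d L : L 0 -> (forall c x y, L x -> L y -> L (c *: x + y)) ->
  (forall s, size s = d -> L (fword s)) ->
  forall x, x \in fdegree d -> L x.
Proof.
move=> L0 LP Lw x /allP xd; rewrite (freealgE x) big_seq.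
elim/big_rec: _ => [|s y sx Ly]; first exact: L0.
by apply: LP => //; apply: Lw; apply/eqP/xd.
Qed.

Lemma freealg_ind L : L 0 -> (forall c x y, L x -> L y -> L (c *: x + y)) ->
  (forall s, L (fword s)) -> forall x, L x.
Proof.
move=> L0 LP Lw x; rewrite (freealgE x).
by elim/big_rec: _ => [|s y _ Ly]; [exact: L0|exact: LP].
Qed.

Lemma fdegreeP d x :
  reflect (forall s, size s != d -> fcoef s x = 0) (x \in fdegree d).
Proof.
apply: (iffP allP) => xd s.
  by move=> sd; apply/eqP; apply: contraNT sd; rewrite -mem_fsupp; exact: xd.
by rewrite mem_fsupp; apply: contraNT => /xd ->.
Qed.

Lemma fword_fdegree s : (fword s : FA) \in fdegree (size s).
Proof.
apply/fdegreeP => t ts; rewrite fcoef_word; case: eqP => // st.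
by rewrite st eqxx in ts.
Qed.

Lemma fdegree0 d : (0 : FA) \in fdegree d.
Proof. by apply/fdegreeP => s _; rewrite raddf0. Qed.

Lemma fdegreeP_lin d c x y :
  x \in fdegree d -> y \in fdegree d -> c *: x + y \in fdegree d.
Proof.
move=> /fdegreeP xd /fdegreeP yd; apply/fdegreeP => s sd.
by rewrite linearP /= xd ?yd // mulr0 addr0.
Qed.

Lemma fdegreeZ d c x : x \in fdegree d -> c *: x \in fdegree d.
Proof. by move=> xd; rewrite -[_ *: x]addr0; apply: fdegreeP_lin (fdegree0 _). Qed.

Lemma fdegreeD d x y : x \in fdegree d -> y \in fdegree d -> x + y \in fdegree d.
Proof. by move=> xd yd; rewrite -[x]scale1r; exact: fdegreeP_lin. Qed.

Lemma fdegree_sum d (I : Type) (r : seq I) (F : I -> FA) :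
  (forall i, F i \in fdegree d) -> \sum_(i <- r) F i \in fdegree d.
Proof.
by move=> Fd; elim/big_rec: _ => [|i y _ yd]; [exact: fdegree0|exact: fdegreeD].
Qed.

Lemma fdegreeM d1 d2 x y :
  x \in fdegree d1 -> y \in fdegree d2 -> x * y \in fdegree (d1 + d2).
Proof.
move=> xd yd; elim/(@fdegree_ind d1): x / xd => [|c x x' IH IH'|s <-].
- by rewrite mul0r; exact: fdegree0.
- by rewrite mulrDl -scalerAl; exact: fdegreeP_lin.
elim/(@fdegree_ind d2): y / yd => [|c y y' IH IH'|t <-].
- by rewrite mulr0; exact: fdegree0.
- by rewrite mulrDr -scalerAr; exact: fdegreeP_lin.
by rewrite -fword_cat -size_cat; exact: fword_fdegree.
Qed.

(** The linear map with value [g s] on the word [s]. Unlike [feval] it need not be multiplicative,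
    so it also yields projections and signed derivations. *)
Definition fext (M : lmodType k) (g : seq 'I_n -> M) x : M :=
  \sum_(s <- fsupp x) fcoef s x *: g s.

Section Ext.
Context (M : lmodType k) (g : seq 'I_n -> M).

Lemma fextEw r x : uniq r -> {subset fsupp x <= r} ->
  fext g x = \sum_(s <- r) fcoef s x *: g s.
Proof.
move=> r_uniq xr; rewrite [RHS](bigID (mem (fsupp x))) /=.
rewrite [X in _ + X]big1 ?addr0; last first.
  by move=> s; rewrite mem_fsupp negbK => /eqP->; rewrite scale0r.
rewrite -[RHS]big_filter; apply: perm_big; apply: uniq_perm.
- exact: fsupp_uniq.
- exact: filter_uniq.
by move=> s; rewrite mem_filter; case: (boolP (s \in fsupp x)) => // /xr ->.
Qed.

Fact fext_is_linear : linear (fext g).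
Proof.
move=> c x y; pose r := undup (fsupp x ++ fsupp y ++ fsupp (c *: x + y)).
have sub z : z \in [:: x; y; c *: x + y] -> {subset fsupp z <= r}.
  by rewrite !inE => /or3P[] /eqP-> s zs; rewrite mem_undup !mem_cat zs ?orbT.
rewrite !(@fextEw r) ?undup_uniq //; try by apply: sub; rewrite !inE eqxx ?orbT.
rewrite scaler_sumr -big_split /=; apply: eq_bigr => s _.
by rewrite linearP scalerDl scalerA.
Qed.

HB.instance Definition _ :=
  GRing.isLinear.Build k FA M *:%R (fext g) fext_is_linear.

Lemma fext_word s : fext g (fword s) = g s.
Proof.
rewrite (@fextEw [:: s]) //; first by rewrite big_seq1 fcoef_word eqxx scale1r.
move=> t; rewrite mem_fsupp fcoef_word inE [t == _]eq_sym.
by case: (s == t); rewrite /= ?eqxx.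
Qed.

End Ext.

(** The projection onto degree [d]. It separates the homogeneous parts of a relation and shows that
    the grading of a quotient is direct. *)
Definition fhom d : FA -> FA :=
  fext (fun s => if size s == d then fword s else 0).
HB.instance Definition _ d := GRing.Linear.on (fhom d).

Lemma fhom_fdegree d x : fhom d x \in fdegree d.
Proof.
elim/freealg_ind: x => [|c x y xd yd|s].
- by rewrite linear0; exact: fdegree0.
- by rewrite linearP; exact: fdegreeP_lin.
rewrite /fhom fext_word; case: eqP => [<-|_]; first exact: fword_fdegree.
exact: fdegree0.
Qed.

Lemma fhom_id d m x : x \in fdegree m -> fhom d x = if m == d then x else 0.
Proof.
move=> xm; elim/(@fdegree_ind m): x / xm => [|c x y xd yd|s <-].
- by rewrite linear0 if_same.
- rewrite linearP /= xd yd; case: ifP => _ //; by rewrite scaler0 addr0.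
by rewrite /fhom fext_word.
Qed.

Lemma fhom_sum x : exists m, x = \sum_(i < m) fhom i x.
Proof.
pose m := (\max_(s <- fsupp x) size s).+1; exists m.
rewrite [LHS]freealgE; apply/freealgP => s.
rewrite -freealgE linear_sum /=.
have fhE i : fcoef s (fhom i x) = if size s == i then fcoef s x else 0.
  elim/freealg_ind: x {m} => [|c x y xd yd|t].
  - by rewrite !raddf0 if_same.
  - by rewrite !linearP /= xd yd; case: ifP => _ //; rewrite mulr0 addr0.
  rewrite /fhom fext_word; have [<-|ts] := eqVneq t s.
    by case: eqP => _; rewrite ?raddf0.
  by case: (size t == i); rewrite ?raddf0 fcoef_word (negPf ts) if_same.
under eq_bigr do rewrite fhE.
have [sm|sm] := ltnP (size s) m.
  rewrite (bigD1 (Ordinal sm)) //= eqxx big1 ?addr0 // => i.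
  by rewrite -val_eqE eq_sym => /negPf /= ->.
rewrite big1 => [|i _]; last first.
  by case: eqP => // si; move: (ltn_ord i); rewrite -si ltnNge sm.
apply/eqP; rewrite -[_ == _]negbK -mem_fsupp; apply/negP => sx.
suff: (size s <= \max_(s <- fsupp x) size s)%N by rewrite leqNgt sm.
exact: (leq_bigmax_seq (F := size)).
Qed.

(* The bilinear form for which the words are orthonormal. *)
Definition fdot x y : k := \sum_(s <- fsupp x) fcoef s x * fcoef s y.

Fact fdot_is_scalar x : scalar (fdot x).
Proof.
move=> c y z; rewrite /fdot mulr_sumr -big_split; apply: eq_bigr => s _ /=.
by rewrite linearP /=; ring.
Qed.
HB.instance Definition _ x :=
  GRing.isLinear.Build k FA k *%R (fdot x) (fdot_is_scalar x).

(** The definition sums over the support of the first argument only; both sides are rewritten as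
    sums over the union of the two supports. *)
Lemma fdotC x y : fdot x y = fdot y x.
Proof.
have dE u v (r := undup (fsupp x ++ fsupp y)) : {subset fsupp u <= r} ->
    fdot u v = \sum_(s <- r) fcoef s u * fcoef s v.
  move=> ur; rewrite /fdot [RHS](bigID (mem (fsupp u))) /=.
  rewrite [X in _ = _ + X]big1 ?addr0; last first.
    by move=> s; rewrite mem_fsupp negbK => /eqP->; rewrite mul0r.
  rewrite -[RHS]big_filter; apply: perm_big; apply: uniq_perm.
  - exact: fsupp_uniq.
  - by apply: filter_uniq; exact: undup_uniq.
  by move=> s; rewrite mem_filter; case: (boolP (s \in fsupp u)) => // /ur ->.
rewrite !dE; first by apply: eq_bigr => s _; rewrite mulrC.
  by move=> s sy; rewrite mem_undup mem_cat sy orbT.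
by move=> s sy; rewrite mem_undup mem_cat sy.
Qed.

Lemma fdot_linl c x y z : fdot (c *: x + y) z = c * fdot x z + fdot y z.
Proof. by rewrite !(fdotC _ z) linearP. Qed.

Lemma fdot0l x : fdot 0 x = 0.
Proof. by rewrite fdotC raddf0. Qed.

Lemma fdotBl x y z : fdot (x - y) z = fdot x z - fdot y z.
Proof. by rewrite !(fdotC _ z) linearB. Qed.

Lemma fdot_wordl s x : fdot (fword s) x = fcoef s x.
Proof.
rewrite fdotC; elim/freealg_ind: x => [|c x y xd yd|t].
- by rewrite fdot0l raddf0.
- by rewrite fdot_linl linearP /= xd yd.
rewrite fdotC /fdot (_ : fsupp (fword s) = [:: s]).
  by rewrite big_seq1 !fcoef_word eqxx mul1r.
apply: perm_small_eq; first by [].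
apply: uniq_perm; first exact: fsupp_uniq; first by [].
move=> r; rewrite mem_fsupp fcoef_word inE [r == s]eq_sym.
by case: (s == r); rewrite ?oner_eq0 ?eqxx.
Qed.

(** When the first factors have the same length, two concatenations of words agree exactly if the
    factors agree. *)
Lemma fdotM d d' x x' y y' : x \in fdegree d -> y \in fdegree d ->
  x' \in fdegree d' -> y' \in fdegree d' ->
  fdot (x * x') (y * y') = fdot x y * fdot x' y'.
Proof.
move=> xd yd xd' yd'; elim/(@fdegree_ind d): x / xd => [|c u v IHu IHv|s sd].
- by rewrite mul0r !fdot0l mul0r.
- by rewrite mulrDl -scalerAl !fdot_linl IHu IHv; ring.
elim/(@fdegree_ind d'): x' / xd' => [|c u v IHu IHv|s' sd'].
- by rewrite mulr0 !fdot0l mulr0.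
- by rewrite mulrDr -scalerAr !fdot_linl IHu IHv; ring.
rewrite -fword_cat !fdot_wordl.
elim/(@fdegree_ind d): y / yd => [|c u v IHu IHv|t td].
- by rewrite mul0r !raddf0 mul0r.
- by rewrite mulrDl -scalerAl !linearP /= IHu IHv; ring.
elim/(@fdegree_ind d'): y' / yd' => [|c u v IHu IHv|t' td'].
- by rewrite mulr0 !raddf0 mulr0.
- by rewrite mulrDr -scalerAr !linearP /= IHu IHv; ring.
rewrite -fword_cat !fcoef_word eqseq_cat ?sd //.
by case: eqP; case: eqP; rewrite /= ?mulr0 ?mul0r ?mulr1.
Qed.

(** Words are grouped by their last letter, which presents degree [d.+1] as degree [d] tensored with
    the generators. *)
Lemma fdegree_splitr d x : x \in fdegree d.+1 ->
  exists2 q : 'I_n -> FA, (forall c, q c \in fdegree d) &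
    x = \sum_c q c * fword [:: c].
Proof.
move=> xd; elim/(@fdegree_ind d.+1): x / xd => [|c x y [q qd ->] [r rd ->]|s].
- exists (fun _ => 0) => [_|]; first exact: fdegree0.
  by rewrite big1 // => i _; rewrite mul0r.
- exists (fun i => c *: q i + r i) => [i|]; first exact: fdegreeP_lin.
  rewrite scaler_sumr -big_split; apply: eq_bigr => i _ /=.
  by rewrite mulrDl scalerAl.
case/lastP: s => // s a; rewrite size_rcons => -[sd].
exists (fun c => if c == a then fword s else 0) => [c|].
  by case: eqP => _; [rewrite -sd; exact: fword_fdegree|exact: fdegree0].
rewrite (bigD1 a) //= eqxx -fword_cat cats1 big1 ?addr0 // => i /negPf ->.
by rewrite mul0r.
Qed.

Lemma fdegree_splitl d x : x \in fdegree d.+1 ->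
  exists2 q : 'I_n -> FA, (forall c, q c \in fdegree d) &
    x = \sum_c fword [:: c] * q c.
Proof.
move=> xd; elim/(@fdegree_ind d.+1): x / xd => [|c x y [q qd ->] [r rd ->]|s].
- exists (fun _ => 0) => [_|]; first exact: fdegree0.
  by rewrite big1 // => i _; rewrite mulr0.
- exists (fun i => c *: q i + r i) => [i|]; first exact: fdegreeP_lin.
  rewrite scaler_sumr -big_split; apply: eq_bigr => i _ /=.
  by rewrite mulrDr scalerAr.
case: s => //= a s [sd].
exists (fun c => if c == a then fword s else 0) => [c|].
  by case: eqP => _; [rewrite -sd; exact: fword_fdegree|exact: fdegree0].
rewrite (bigD1 a) //= eqxx -fword_cat big1 ?addr0 // => i /negPf ->.
by rewrite mulr0.
Qed.

Lemma fdegree_tupleE d x : x \in fdegree d ->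
  x = \sum_(t : d.-tuple 'I_n) fcoef t x *: fword t.
Proof.
move=> /fdegreeP xd; apply/freealgP => s; rewrite linear_sum /=.
under eq_bigr do rewrite fcoefZ fcoef_word.
have [sd|sd] := eqVneq (size s) d; last first.
  rewrite xd // big1 // => t _; case: eqP => [ts|]; last by rewrite mulr0.
  by rewrite -ts size_tuple eqxx in sd.
rewrite (bigD1 (tcast sd (in_tuple s))) //= val_tcast eqxx mulr1.
rewrite big1 ?addr0 // => t ts; case: eqP => [e|]; last by rewrite mulr0.
case/eqP: ts; apply: val_inj; rewrite /= val_tcast; exact: e.
Qed.

(** Degree [d] is finite-dimensional with the words of length [d] as an orthonormal basis, so the
    double annihilator property of row vectors carries over. *)
Lemma fdot_bipolar d (S : {pred FA}) x : submod_closed S -> x \in fdegree d ->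
  (forall q, q \in fdegree d ->
     (forall v, v \in S -> v \in fdegree d -> fdot v q = 0) -> fdot x q = 0) ->
  x \in S.
Proof.
move=> [S0 SP] xd xS.
pose T : finType := d.-tuple 'I_n.
pose F (r : 'rV[k]_#|T|) : FA := \sum_(t : T) r 0 (enum_rank t) *: fword t.
have Fd r : F r \in fdegree d.
  apply: fdegree_sum => t; apply: fdegreeZ.
  by rewrite -[X in fdegree X](size_tuple t); exact: fword_fdegree.
have FP c u v : F (c *: u + v) = c *: F u + F v.
  rewrite /F scaler_sumr -big_split; apply: eq_bigr => t _ /=.
  by rewrite !mxE scalerDl scalerA.
have F0 : F 0 = 0 by rewrite /F big1 // => t _; rewrite mxE scale0r.
have Fdot r (q : 'cV_#|T|) : (r *m q) 0 0 = fdot (F r) (F q^T).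
  rewrite fdotC {1}/F fdotC linear_sum /= mxE (reindex enum_rank) /=; last first.
    by apply: onW_bij; exact: enum_rank_bij.
  apply: eq_bigr => t _; rewrite linearZ /= fdotC fdot_wordl mxE mulrC.
  congr (_ * _); rewrite /F linear_sum (bigD1 t) //= big1 => [|t' t't].
    by rewrite fcoefZ fcoef_word eqxx mulr1 addr0.
  by rewrite fcoefZ fcoef_word val_eqE (negPf t't) mulr0.
pose r0 : 'rV[k]_#|T| := \row_i fcoef (enum_val i : T) x.
have Fr0 : F r0 = x.
  rewrite [RHS](fdegree_tupleE xd); apply: eq_bigr => t _.
  by rewrite mxE enum_rankK.
rewrite -Fr0; apply: (@bipolar _ _ [pred r | F r \in S]).
  by split=> [|c u v]; rewrite !inE ?F0 // FP; exact: SP.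
move=> q qS; apply/rowP => i; rewrite ord1 [RHS]mxE Fdot Fr0.
apply: xS => // v vS vd.
pose r : 'rV[k]_#|T| := \row_i fcoef (enum_val i : T) v.
have Fv : F r = v.
  rewrite [RHS](fdegree_tupleE vd); apply: eq_bigr => t _.
  by rewrite mxE enum_rankK.
have /qS/(congr1 (fun M : 'M__ => M 0 0)) : r \in [pred r | F r \in S].
  by rewrite inE Fv.
by rewrite Fdot Fv mxE.
Qed.

End FreeAlgebraExtra.

(** * Derivations of degree +1 on the free algebra *)

Section SignedDerivation.
Context {k : fieldType} {n : nat}.
Local Notation FA := (freealg k n).
Implicit Types (x y : FA) (s : seq 'I_n) (L : FA -> Prop).

Lemma freealg_cons_ind L : L 0 -> (forall c x y, L x -> L y -> L (c *: x + y)) ->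
  L 1 -> (forall a x, L x -> L (fword [:: a] * x)) -> forall x, L x.
Proof.
move=> L0 LP L1 LM; apply: freealg_ind => //.
elim=> [|a s IHs]; first by rewrite fword0.
by rewrite -cat1s fword_cat; exact: LM.
Qed.

Variable delta : 'I_n -> FA.

(** The signed Leibniz rule applied to the first letter: [delta] gives the values on generators, and
    the minus sign is the cost of passing a letter of degree 1. *)
Fixpoint sder_word s : FA :=
  if s is a :: s' then delta a * fword s' - fword [:: a] * sder_word s' else 0.

Definition sder : FA -> FA := fext sder_word.
HB.instance Definition _ := GRing.Linear.on sder.

Lemma sder_gen a : sder (fword [:: a]) = delta a.
Proof. by rewrite /sder fext_word /= fword0 mulr1 mulr0 subr0. Qed.

Lemma sder1 : sder 1 = 0.
Proof. by rewrite -fword0 /sder fext_word. Qed.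

Lemma sderM d x y : x \in fdegree d ->
  sder (x * y) = sder x * y + (-1) ^+ d *: (x * sder y).
Proof.
(* The recursion on words extends linearly to an arbitrary right factor; the sign then builds up one
   letter of [x] at a time. *)
have sder_cons a z : sder (fword [:: a] * z) = delta a * z - fword [:: a] * sder z.
  elim/(@freealg_ind k n): z => [|c u v IHu IHv|s].
  - by rewrite !(mulr0, linear0, addr0).
  - rewrite mulrDr -scalerAr !linearP /= IHu IHv !mulrDr -!scalerAr.
    by rewrite scalerBr opprD addrACA.
  by rewrite -fword_cat /sder !fext_word.
move=> xd; elim/(@fdegree_ind k n d): x / xd => [|c u v IHu IHv|s].
- by rewrite !(mul0r, linear0, scaler0, addr0).
- rewrite mulrDl -scalerAl !linearP /= IHu IHv !mulrDl -!scalerAl !scalerDr.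
  by rewrite addrACA !scalerA [c * _]mulrC.
elim: s d => [|a s IHs] d <-.
  by rewrite fword0 sder1 mul0r expr0 scale1r !mul1r add0r.
rewrite -cat1s fword_cat -mulrA !sder_cons (IHs _ erefl).
rewrite mulrDr mulrBl !mulrA opprD addrA -scalerAr; congr (_ + _).
by rewrite exprS mulN1r scaleNr mulrA.
Qed.

Hypothesis delta2 : forall a, delta a \in fdegree 2.

Lemma sder_fdegree d x : x \in fdegree d -> sder x \in fdegree d.+1.
Proof.
move=> xd; elim/(@fdegree_ind k n d): x / xd => [|c u v IHu IHv|s].
- by rewrite linear0; exact: fdegree0.
- by rewrite linearP; exact: fdegreeP_lin.
elim: s d => [|a s IHs] d <-; first by rewrite fword0 sder1; exact: fdegree0.
rewrite -cat1s fword_cat (@sderM 1) ?fword_fdegree // sder_gen.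
apply: fdegreeD; first by apply: (@fdegreeM _ _ 2) => //; exact: fword_fdegree.
apply: fdegreeZ; apply: (@fdegreeM _ _ 1); first exact: fword_fdegree.
exact: IHs.
Qed.

(** The two mixed terms have opposite signs because [sder] raises the degree by one. Thus the square
    is an unsigned derivation, comparable with a commutator on generators alone. *)
Lemma sder_sqrM d x y : x \in fdegree d ->
  sder (sder (x * y)) = sder (sder x) * y + x * sder (sder y).
Proof.
move=> xd; rewrite (sderM _ xd) linearD linearZ /= (sderM _ xd).
rewrite (sderM _ (sder_fdegree xd)) scalerDr scalerA -expr2 sqrr_sign scale1r.
by rewrite addrA -[X in X + _]addrA exprS mulN1r scaleNr addNr addr0.
Qed.

End SignedDerivation.

(** * Gradings and induced derivations of quadratic algebras *)

Section Quadratic.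
Context {k : fieldType} {U : vectType k}.
Variable S : {pred tensor k U}.
Local Notation T := (tensor k U).
Local Notation I := (qideal S).
Implicit Types (x y : T) (L : T -> Prop).

Lemma qidealZ c x : x \in I -> c *: x \in I.
Proof. by rewrite -mulr_algl; exact: qideal_mull. Qed.

Lemma qideal_rel p : p \in S -> p \in fdegree 2 -> p \in I.
Proof.
move=> pS p2; apply/qidealP; rewrite -[p]mul1r -[1 * p]mulr1.
by apply: ideal_genM.
Qed.

(** Expanding both multipliers of a relation into words leaves homogeneous terms, as needed for
    projections and the Leibniz rule. *)
Lemma qideal_ind L : L 0 -> (forall c x y, L x -> L y -> L (c *: x + y)) ->
  (forall s t p, p \in S -> p \in fdegree 2 -> L (fword s * p * fword t)) ->
  forall x, x \in I -> L x.
Proof.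
move=> L0 LP Lw x /qidealP.
elim=> {x} [//|a p b [pS p2]|x y _ IHx _ IHy]; last first.
  by rewrite -[x]scale1r; exact: LP.
elim/(@freealg_ind k (\dim {:U})): a => [|c u v IHu IHv|s].
- by rewrite !mul0r.
- by rewrite !mulrDl -!scalerAl; exact: LP.
elim/(@freealg_ind k (\dim {:U})): b => [|c u v IHu IHv|t].
- by rewrite !mulr0.
- by rewrite !mulrDr -!scalerAr; exact: LP.
exact: Lw.
Qed.

(** Each spanning element [fword s * p * fword t] of the ideal lives in a single degree, so the
    projection keeps or kills it. *)
Lemma qideal_fhom d x : x \in I -> fhom d x \in I.
Proof.
move=> xI; elim/qideal_ind: x / xI => [|c x y xI yI|s t p pS p2].
- by rewrite linear0 rpred0.
- by rewrite linearP /= rpredD ?qidealZ.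
have spt : fword s * p * fword t \in fdegree (size s + 2 + size t).
  by apply: fdegreeM; [apply: fdegreeM => //|]; exact: fword_fdegree.
rewrite (fhom_id _ spt); case: eqP => _; last exact: rpred0.
exact/qideal_mulr/qideal_mull/qideal_rel.
Qed.

Lemma qgrP d b : reflect (exists2 x, x \in fdegree d & b = qproj S x) (b \in qgr S d).
Proof. exact: asboolP. Qed.

Lemma qproj_qgr d x : x \in fdegree d -> qproj S x \in qgr S d.
Proof. by move=> xd; apply/qgrP; exists x. Qed.

Lemma qgr_is_graded : is_graded (qgr S).
Proof.
split.
- move=> d; split; first by rewrite -(linear0 (qproj S)); exact/qproj_qgr/fdegree0.
  move=> c _ _ /qgrP[x xd ->] /qgrP[y yd ->].
  by rewrite -linearP; exact/qproj_qgr/fdegreeP_lin.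
- by rewrite -(rmorph1 (qproj S)) -fword0; exact/qproj_qgr/fword_fdegree.
- move=> d d' _ _ /qgrP[x xd ->] /qgrP[y yd ->].
  by rewrite -rmorphM; exact/qproj_qgr/fdegreeM.
- move=> b; have [x ->] := qprojP b; have [m xE] := fhom_sum x.
  exists m, (fun i : 'I_m => qproj S (fhom i x)); split=> [i|].
    exact/qproj_qgr/fhom_fdegree.
  by rewrite {1}xE linear_sum.
- move=> m c cgr c0 i.
  (* Homogeneous lifts sum to an element of the ideal; its projection to degree [i] stays in the
     ideal and is the [i]-th lift. *)
  have [x xd cE] : exists2 x : 'I_m -> T, forall i, x i \in fdegree i &
      forall i, c i = qproj S (x i).
    have H i' := cid2 (qgrP _ _ (cgr i')).
    by exists (fun i => s2val (H i)) => i'; case: (H i').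
  have : \sum_i x i \in I.
    rewrite -qproj_eq0 linear_sum /=; apply/eqP; rewrite -[RHS]c0.
    by apply: eq_bigr => i' _; rewrite cE.
  move/(qideal_fhom i); rewrite linear_sum /= (bigD1 i) //= big1 => [|l li].
    by rewrite (fhom_id _ (xd i)) eqxx addr0 -qproj_eq0 cE => /eqP.
  by rewrite (fhom_id _ (xd l)) val_eqE (negPf li).
move=> d; exists #|{: d.-tuple 'I_(\dim {:U})}|.
exists (fun i => qproj S (fword (enum_val i : d.-tuple _))).
move=> _ /qgrP[x xd ->]; exists (fun i => fcoef (enum_val i : d.-tuple _) x).
rewrite {1}(fdegree_tupleE xd) linear_sum.
rewrite (reindex (@enum_val _ {: d.-tuple 'I_(\dim {:U})})) /=; last first.
  by apply: onW_bij; exact: enum_val_bij.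
by apply: eq_bigr => i _; rewrite linearZ.
Qed.

Lemma mulr_signZ (B : algType k) d (z : B) : (-1) ^+ d * z = (-1) ^+ d *: z.
Proof.
rewrite -signr_odd -[in RHS]signr_odd.
by case: (odd d); rewrite ?expr1 ?expr0 ?mulN1r ?scaleN1r ?mul1r ?scale1r.
Qed.

Section QuotientDerivation.
Variable delta : 'I_(\dim {:U}) -> T.
Hypothesis delta2 : forall a, delta a \in fdegree 2.
Hypothesis deltaS : forall p, p \in S -> p \in fdegree 2 -> sder delta p \in I.

(** Computed on a chosen representative; [sder_qideal] makes the result independent of the
    choice. *)
Definition qsder (b : qalg S) : qalg S := qproj S (sder delta (qrepr b)).

(** By the Leibniz rule, differentiating either outer word leaves the factor [p], while
    differentiating [p] itself is covered by [deltaS]. *)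
Lemma sder_qideal x : x \in I -> sder delta x \in I.
Proof.
move=> xI; elim/qideal_ind: x / xI => [|c x y xI yI|s t p pS p2].
- by rewrite linear0 rpred0.
- by rewrite linearP /= rpredD ?qidealZ.
have pI := qideal_rel pS p2.
rewrite -mulrA (sderM _ _ (fword_fdegree s)) (sderM _ _ p2) rpredD //.
  exact/qideal_mull/qideal_mulr.
apply/qidealZ/qideal_mull; rewrite rpredD //; first exact/qideal_mulr/deltaS.
exact/qidealZ/qideal_mulr.
Qed.

Lemma qsder_proj x : qsder (qproj S x) = qproj S (sder delta x).
Proof.
apply/eqP; rewrite qproj_eq -linearB /=; apply: sder_qideal.
by rewrite -[_ - _]opprB rpredN; exact: qreprP.
Qed.

Lemma qsder_is_derivation1 : is_derivation1 (qgr S) qsder.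
Proof.
split.
- move=> c u v; have [x ->] := qprojP u; have [y ->] := qprojP v.
  by rewrite -linearP !qsder_proj !linearP.
- move=> d _ /qgrP[x xd ->]; rewrite qsder_proj.
  exact/qproj_qgr/sder_fdegree.
move=> d u v /qgrP[x xd ->]; have [y ->] := qprojP v.
rewrite -rmorphM !qsder_proj (sderM _ _ xd) linearD linearZ /= !rmorphM /=.
by rewrite mulr_signZ.
Qed.

(** The square of [qsder] and the commutator with [h] are both unsigned derivations, so their
    agreement spreads from generators to products. *)
Lemma qsder_curv (eta : T) (h := qproj S eta) :
  (forall a, sder delta (delta a)
     - (eta * fword [:: a] - fword [:: a] * eta) \in I) ->
  forall b, qsder (qsder b) = h * b - b * h.
Proof.
move=> H b; have [x ->] := qprojP b; rewrite !qsder_proj.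
elim/(@freealg_cons_ind k (\dim {:U})): x => [|c x y IHx IHy||a x IHx].
- by rewrite !linear0 mulr0 mul0r subrr.
- rewrite !linearP /= IHx IHy mulrDr mulrDl -scalerAr -scalerAl scalerBr opprD.
  by rewrite addrACA.
- by rewrite sder1 !linear0 rmorph1 mulr1 mul1r subrr.
rewrite (sder_sqrM _ _ (fword_fdegree [:: a])) // sder_gen.
rewrite linearD /= !rmorphM /= IHx.
have /eqP -> : qproj S (sder delta (delta a)) ==
    qproj S (eta * fword [:: a] - fword [:: a] * eta) by rewrite qproj_eq.
rewrite linearB /= !rmorphM /= -/h mulrBl mulrBr !mulrA.
by rewrite addrA subrK.
Qed.

End QuotientDerivation.
End Quadratic.

(** * Duality between tensors over a space and over its dual *)

Section Duality.
Context {k : fieldType} {U : vectType k}.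
Local Notation T := (tensor k U).
Local Notation T' := (tensor k (dual U)).
Local Notation e := (vbasis {:U}).
Local Notation e' := (vbasis {:dual U}).
Implicit Types (al : dual U) (u : U) (ga : T') (x p q : T).

Lemma coord_vbasis_delta (V : vectType k) (i l : 'I_(\dim {:V})) :
  coord (vbasis {:V}) i (vbasis {:V})`_l = (l == i)%:R.
Proof. by rewrite coord_free ?(basis_free (vbasisP _)) // eq_sym. Qed.

Lemma tgen_basis (V : vectType k) (i : 'I_(\dim {:V})) :
  tgen (vbasis {:V})`_i = fword [:: i].
Proof.
rewrite /tgen (bigD1 i) //= coord_vbasis_delta eqxx scale1r big1 ?addr0 // => l.
by rewrite coord_vbasis_delta eq_sym => /negPf ->; rewrite scale0r.
Qed.

Lemma tgen_fdegree (V : vectType k) (v : V) : tgen v \in fdegree 1.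
Proof. by apply: fdegree_sum => i; apply: fdegreeZ; exact: fword_fdegree. Qed.

Lemma tgen_inj (V : vectType k) : injective (@tgen k V).
Proof.
move=> u v uv; rewrite (coord_vbasis (memvf u)) (coord_vbasis (memvf v)).
have cE (w : V) i : coord (vbasis {:V}) i w = fcoef [:: i] (tgen w).
  rewrite linear_sum (bigD1 i) //= fcoefZ fcoef_word eqxx mulr1.
  rewrite big1 ?addr0 // => l li.
  by rewrite fcoefZ fcoef_word eqseq_cons (negPf li) mulr0.
by apply: eq_bigr => i _; rewrite !cE uv.
Qed.

Lemma feval_fdegree n m (a : 'I_n -> freealg k m) d y :
  (forall i, a i \in fdegree 1) -> y \in fdegree d -> feval a y \in fdegree d.
Proof.
move=> a1 yd; elim/(@fdegree_ind k n d): y / yd => [|c y z yd zd|s <-].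
- by rewrite linear0; exact: fdegree0.
- by rewrite linearP; exact: fdegreeP_lin.
rewrite feval_word; elim: s => [|i s IHs].
  by rewrite big_nil -fword0; exact: fword_fdegree.
by rewrite big_cons; apply: (@fdegreeM _ _ 1).
Qed.

Definition dual_coord al : T := \sum_(i < \dim {:U}) (al e`_i : k) *: fword [:: i].

Fact dual_coord_is_linear : linear dual_coord.
Proof.
move=> c al be; rewrite /dual_coord scaler_sumr -big_split.
apply: eq_bigr => i _ /=; rewrite add_lfunE scale_lfunE scalerDl.
by congr (_ + _); rewrite [RHS]scalerA.
Qed.
HB.instance Definition _ :=
  GRing.isLinear.Build k (dual U) T *:%R dual_coord dual_coord_is_linear.

Lemma dual_coord_fdegree al : dual_coord al \in fdegree 1.
Proof. by apply: fdegree_sum => i; apply: fdegreeZ; exact: fword_fdegree. Qed.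

Lemma fdot_dual_coord al u : fdot (dual_coord al) (tgen u) = al u.
Proof.
rewrite fdotC [dual_coord al]/dual_coord linear_sum /=.
rewrite [in RHS](coord_vbasis (memvf u)) linear_sum /=; apply: eq_bigr => i _.
rewrite !linearZ /= fdotC fdot_wordl mulrC; congr (_ * _).
rewrite /tgen linear_sum (bigD1 i) //= fcoefZ fcoef_word eqxx mulr1.
rewrite big1 ?addr0 // => l li.
by rewrite fcoefZ fcoef_word eqseq_cons (negPf li) mulr0.
Qed.

(* T(U^* ) is identified with T(U) through the basis dual to e. *)
Definition dual_tensor : T' -> T := tlift dual_coord.
HB.instance Definition _ := GRing.LRMorphism.on dual_tensor.

Lemma dual_tensor_gen al : dual_tensor (tgen al) = dual_coord al.
Proof. exact: tlift_gen. Qed.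

Lemma dual_tensor_fdegree d ga : ga \in fdegree d -> dual_tensor ga \in fdegree d.
Proof. by apply: feval_fdegree => i; exact: dual_coord_fdegree. Qed.

Definition coord_form (i : 'I_(\dim {:U})) u : k^o := coord e i u.

Fact coord_form_is_linear i : linear (coord_form i).
Proof. by move=> c u v; rewrite /coord_form linearP. Qed.
HB.instance Definition _ i :=
  GRing.isLinear.Build k U k^o *:%R (coord_form i) (coord_form_is_linear i).

Definition dual_basis i : dual U := linfun (coord_form i).

Lemma dual_basisE i u : dual_basis i u = coord e i u.
Proof. by rewrite lfunE. Qed.

(** The inverse of [dual_tensor]. The basis [e'] supplied by [vbasis] need not be dual to [e], so
    letters are sent to dual basis forms rather than to letters. *)
Definition tensor_dual : T -> T' := feval (fun i => tgen (dual_basis i)).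
HB.instance Definition _ := GRing.LRMorphism.on tensor_dual.

Lemma tensor_dual_fdegree d x : x \in fdegree d -> tensor_dual x \in fdegree d.
Proof. by apply: feval_fdegree => i; exact: tgen_fdegree. Qed.

Lemma tensor_dual_coord al : tensor_dual (dual_coord al) = tgen al.
Proof.
rewrite linear_sum /=; under eq_bigr do
  rewrite linearZ /= [tensor_dual _]feval_word big_seq1 -linearZ.
rewrite -linear_sum; congr tgen; apply/lfunP => u.
rewrite sum_lfunE [in RHS](coord_vbasis (memvf u)) linear_sum.
apply: eq_bigr => i _ /=.
by rewrite scale_lfunE dual_basisE linearZ [LHS]mulrC.
Qed.

Lemma dual_tensorK : cancel dual_tensor tensor_dual.
Proof.
elim/(@freealg_cons_ind k (\dim {:dual U})) => [|c y z IHy IHz||a y IHy].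
- by rewrite !linear0.
- by rewrite !linearP /= IHy IHz.
- by rewrite !rmorph1.
by rewrite !rmorphM /= IHy -tgen_basis dual_tensor_gen tensor_dual_coord.
Qed.

Lemma tensor_dualK : cancel tensor_dual dual_tensor.
Proof.
elim/(@freealg_cons_ind k (\dim {:U})) => [|c y z IHy IHz||a y IHy].
- by rewrite !linear0.
- by rewrite !linearP /= IHy IHz.
- by rewrite !rmorph1.
rewrite !rmorphM /= IHy [tensor_dual (fword _)]feval_word big_seq1 dual_tensor_gen.
congr (_ * _); rewrite /dual_coord (bigD1 a) //= dual_basisE.
rewrite coord_vbasis_delta eqxx scale1r big1 ?addr0 // => i ia.
by rewrite dual_basisE coord_vbasis_delta (negPf ia) scale0r.
Qed.

Lemma pairing_linl c ga ga' x :
  pairing (c *: ga + ga') x = c * pairing ga x + pairing ga' x.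
Proof.
rewrite /pairing mulr_sumr -big_split; apply: eq_bigr => a _ /=.
rewrite mulr_sumr -big_split; apply: eq_bigr => b _ /=.
rewrite mulr_sumr -big_split; apply: eq_bigr => i _ /=.
rewrite mulr_sumr -big_split; apply: eq_bigr => l _ /=.
by rewrite linearP /=; ring.
Qed.

Lemma pairing0l x : pairing 0 x = 0.
Proof. by rewrite -[0](subrr (0 : T')) -scaleN1r addrC pairing_linl mulN1r addNr. Qed.

(** Both sides are bilinear and agree on products of two generators. Annihilators for [pairing]
    thereby become orthogonal complements for [fdot]. *)
Lemma pairing_fdot ga x : ga \in fdegree 2 -> x \in fdegree 2 ->
  pairing ga x = fdot (dual_tensor ga) x.
Proof.
move=> ga2 x2; elim/(@fdegree_ind k (\dim {:dual U}) 2): ga / ga2 => [|c y z IHy IHz|].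
- by rewrite pairing0l linear0 fdot0l.
- by rewrite pairing_linl linearP /= fdot_linl IHy IHz.
move=> [|a [|b []]] // _.
elim/(@fdegree_ind k (\dim {:U}) 2): x / x2 => [|c y z IHy IHz|].
- by rewrite !linear0.
- by rewrite !linearP /= IHy IHz.
move=> [|i [|l []]] // _.
rewrite -[[:: a; b]]/([:: a] ++ [:: b]) -[[:: i; l]]/([:: i] ++ [:: l]).
rewrite !fword_cat -!tgen_basis pairing_tgen rmorphM /= !dual_tensor_gen.
rewrite (@fdotM _ _ 1 1) ?dual_coord_fdegree ?tgen_fdegree //.
by rewrite !fdot_dual_coord.
Qed.

Lemma fdot_dualMr ga al p u : ga \in fdegree 2 -> p \in fdegree 2 ->
  fdot (dual_tensor (ga * tgen al)) (p * tgen u) = pairing ga p * al u.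
Proof.
move=> ga2 p2; rewrite rmorphM /= dual_tensor_gen.
rewrite (@fdotM _ _ 2 1) ?dual_tensor_fdegree ?dual_coord_fdegree ?tgen_fdegree //.
by rewrite -pairing_fdot // fdot_dual_coord.
Qed.

Lemma fdot_dualMl ga al p u : ga \in fdegree 2 -> p \in fdegree 2 ->
  fdot (dual_tensor (tgen al * ga)) (tgen u * p) = al u * pairing ga p.
Proof.
move=> ga2 p2; rewrite rmorphM /= dual_tensor_gen.
rewrite (@fdotM _ _ 1 2) ?dual_tensor_fdegree ?dual_coord_fdegree ?tgen_fdegree //.
by rewrite -pairing_fdot // fdot_dual_coord.
Qed.

Lemma perpP (S : {pred T}) ga :
  reflect (ga \in fdegree 2 /\ forall p, p \in S -> pairing ga p = 0)
          (ga \in perp S).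
Proof. by apply: (iffP andP) => -[ga2 /asboolP gaS]. Qed.

(* In degree 3, the ideal generated by I^perp is the annihilator of the
   intersection of I (x) U and U (x) I. *)
Lemma qideal_perp3 (S : {pred T}) ga : submod_closed S ->
  {subset S <= fdegree 2} -> ga \in fdegree 3 ->
  (forall p p' : 'I_(\dim {:U}) -> T,
     (forall c, p c \in S) -> (forall c, p' c \in S) ->
     \sum_c p c * fword [:: c] = \sum_c fword [:: c] * p' c ->
     fdot (dual_tensor ga) (\sum_c p c * fword [:: c]) = 0) ->
  ga \in qideal (perp S).
Proof.
move=> Scl S2 ga3 gaS; pose Q := qideal (perp S).
rewrite -(dual_tensorK ga).
(* It suffices to test against each [q] orthogonal to the degree 3 part of the ideal; such a [q] is
   shown to lie in both I (x) U and U (x) I. *)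
apply: (@fdot_bipolar _ _ 3 [pred x | tensor_dual x \in Q]).
- split=> [|c x y]; rewrite !inE; first by rewrite linear0 rpred0.
  by move=> xQ yQ; rewrite linearP /= rpredD ?qidealZ.
- exact: dual_tensor_fdegree.
move=> q q3 qQ.
have [p p2 qp] := fdegree_splitr q3; have [p' p'2 qp'] := fdegree_splitl q3.
have perpQ r : r \in fdegree 2 ->
    (forall v, v \in S -> v \in fdegree 2 -> fdot v r = 0) ->
    tensor_dual r \in Q.
  move=> r2 rS; have tr2 := tensor_dual_fdegree r2.
  apply: qideal_rel => //; apply/perpP; split=> // v vS.
  by rewrite pairing_fdot ?S2 // tensor_dualK fdotC rS ?S2.
rewrite [in fdot _ q]qp; apply: (gaS _ p'); rewrite -?qp -?qp' // => c.
(* For [r] orthogonal to [S], the product of [r] with the letter [c] comes from the ideal, and its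
   form with [q] isolates [p c]. The double annihilator in degree 2 then puts [p c] in [S]. *)
- apply: (fdot_bipolar Scl (p2 c)) => r r2 rS.
  have := qQ (r * fword [:: c]).
  rewrite inE rmorphM /= qideal_mulr ?perpQ // => /(_ isT).
  have c1 : (fword [:: c] : T) \in fdegree 1 by exact: fword_fdegree.
  move/(_ (fdegreeM r2 c1)); rewrite qp linear_sum (bigD1 c) //=.
  rewrite (fdotM r2 (p2 c) c1 c1) fdot_wordl fcoef_word eqxx mulr1 fdotC.
  rewrite big1 ?addr0 // => l lc.
  rewrite (fdotM r2 (p2 l) c1 (fword_fdegree [:: l])) fdot_wordl fcoef_word.
  by rewrite eqseq_cons (negPf lc) mulr0.
apply: (fdot_bipolar Scl (p'2 c)) => r r2 rS.
have := qQ (fword [:: c] * r).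
rewrite inE rmorphM /= qideal_mull ?perpQ // => /(_ isT).
have c1 : (fword [:: c] : T) \in fdegree 1 by exact: fword_fdegree.
move/(_ (fdegreeM c1 r2)); rewrite qp' linear_sum (bigD1 c) //=.
rewrite (fdotM c1 c1 r2 (p'2 c)) fdot_wordl fcoef_word eqxx mul1r fdotC.
rewrite big1 ?addr0 // => l lc.
rewrite (fdotM c1 (fword_fdegree [:: l]) r2 (p'2 l)) fdot_wordl fcoef_word.
by rewrite eqseq_cons (negPf lc) mul0r.
Qed.

End Duality.

(** * Overlaps of relations and the curved differential *)

Section CurvedDifferential.
Context {k : fieldType} {U : vectType k} {A : algType k} {f : {linear U -> A}}.
Variables (phi : {linear relI_space f -> U}) (hI : {scalar relI_space f}).
Hypothesis phi_hI : forall x : tensor k U, x \in relJ2 f <->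
  exists p : relI_space f, x = relI_val p + tgen (phi p) + (hI p)%:A.

Local Notation e := (vbasis {:U}).
Local Notation e' := (vbasis {:dual U}).
Local Notation T := (tensor k U).
Local Notation T' := (tensor k (dual U)).

Lemma relI_fdegree : {subset relI f <= (fdegree 2 : {pred T})}.
Proof. by move=> p /andP[]. Qed.

Lemma relI_val_fdegree (p : relI_space f) : relI_val p \in fdegree 2.
Proof. exact/relI_fdegree/(valP p). Qed.

Lemma relation_eq0 (p : relI_space f) :
  tlift f (relI_val p + tgen (phi p) + (hI p)%:A) = 0.
Proof.
have /andP[_ /eqP //] : relI_val p + tgen (phi p) + (hI p)%:A \in relJ2 f.
by apply/phi_hI; exists p.
Qed.

Lemma fdegree_leW n d d' (x : freealg k n) : (d <= d')%N ->
  x \in fdegree d -> x \in fdegree_le d'.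
Proof. by move=> dd' /allP xd; apply/allP => s /xd /eqP ->. Qed.

Section Overlap.
(* An element of (I (x) U) cap (U (x) I), written in both ways. *)
Variables p p' : 'I_(\dim {:U}) -> relI_space f.
Hypothesis pp' :
  \sum_c relI_val (p c) * fword [:: c] = \sum_c fword [:: c] * relI_val (p' c).

Definition overlap2 : T :=
  \sum_c (tgen (phi (p c)) * tgen e`_c - tgen e`_c * tgen (phi (p' c))).
Definition overlap1 : U := \sum_c (hI (p c) - hI (p' c)) *: e`_c.

Lemma overlap2_fdegree : overlap2 \in fdegree 2.
Proof.
apply: fdegree_sum => c; rewrite addrC -scaleN1r.
by apply: fdegreeP_lin; apply: (@fdegreeM _ _ 1 1); exact: tgen_fdegree.
Qed.

Lemma overlap_relJ2 : overlap2 + tgen overlap1 \in relJ2 f.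
Proof.
have [_ leP] := @fdegree_le_submod k U 2.
apply/andP; split.
  rewrite -[overlap2]scale1r; apply: leP.
    exact: fdegree_leW overlap2_fdegree.
  exact: fdegree_leW (tgen_fdegree _).
(* [R q] is the full relation with leading part [q]. Multiplying by letters on the right for [p] and
   on the left for [p'] and subtracting, the cubic parts cancel by [pp'] and the constant terms
   produce [overlap1]. *)
pose R q := relI_val q + tgen (phi q) + (hI q)%:A.
have -> : overlap2 + tgen overlap1 =
    \sum_c (R (p c) * fword [:: c] - fword [:: c] * R (p' c)).
  transitivity (\sum_c (relI_val (p c) * fword [:: c]
      - fword [:: c] * relI_val (p' c)) + (overlap2 + tgen overlap1)).
    by rewrite sumrB pp' subrr add0r.
  rewrite /overlap2 /overlap1 linear_sum -!big_split; apply: eq_bigr => c _ /=.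
  rewrite linearZ /= tgen_basis /R !mulrDl !mulrDr mulr_algl mulr_algr scalerBl.
  by rewrite !opprD !addrA [LHS](ACl (1*3*5*2*4*6)).
apply/eqP; rewrite linear_sum big1 // => c _.
by rewrite linearB !rmorphM /= !relation_eq0 mul0r mulr0 subrr.
Qed.

(* Comparing the components of degree 2, 1 and 0 of a relation. *)
Lemma overlapP : exists q : relI_space f,
  [/\ overlap2 = relI_val q, overlap1 = phi q & hI q = 0].
Proof.
have [q qE] := (phi_hI _).1 overlap_relJ2; exists q.
have o2 := overlap2_fdegree; have q2 := relI_val_fdegree q.
have o1 := tgen_fdegree overlap1; have q1 := tgen_fdegree (phi q).
have q0 : (hI q)%:A \in (fdegree 0 : {pred T}).
  by apply: fdegreeZ; rewrite -fword0; exact: fword_fdegree.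
split.
- move/(congr1 (fhom 2)): qE; rewrite !linearD /=.
  by rewrite (fhom_id 2 o2) (fhom_id 2 o1) (fhom_id 2 q2) (fhom_id 2 q1)
    (fhom_id 2 q0) /= !addr0.
- apply: tgen_inj; move/(congr1 (fhom 1)): qE; rewrite !linearD /=.
  by rewrite (fhom_id 1 o2) (fhom_id 1 o1) (fhom_id 1 q2) (fhom_id 1 q1)
    (fhom_id 1 q0) /= !addr0 !add0r.
move/(congr1 (fhom 0)): qE; rewrite !linearD /=.
rewrite (fhom_id 0 o2) (fhom_id 0 o1) (fhom_id 0 q2) (fhom_id 0 q1).
rewrite (fhom_id 0 q0) /= !add0r => /(congr1 (fcoef [::])).
by rewrite linear0 fcoefZ -fword0 fcoef_word eqxx mulr1.
Qed.

Variable delta : 'I_(\dim {:dual U}) -> T'.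
Hypothesis delta2 : forall a, delta a \in fdegree 2.
(** This is d_1 = phi^* on the basis [e'], with the values of d_1 lifted to degree 2 tensors. *)
Hypothesis delta_phi : forall (a : 'I_(\dim {:dual U})) (q : relI_space f),
  e'`_a (phi q) = pairing (delta a) (relI_val q).

Lemma fdot_sder_overlap (be : T') : be \in fdegree 2 ->
  fdot (dual_tensor (sder delta be)) (\sum_c relI_val (p c) * fword [:: c])
    = pairing be overlap2.
Proof.
move=> be2; elim/(@fdegree_ind k (\dim {:dual U}) 2): be / be2.
- by rewrite !linear0 fdot0l pairing0l.
- by move=> c x y IHx IHy; rewrite !linearP /= fdot_linl pairing_linl IHx IHy.
move=> [|a [|b []]] // _.
rewrite -[[:: a; b]]/([:: a] ++ [:: b]) fword_cat (@sderM _ _ _ 1) ?fword_fdegree //.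
rewrite !sder_gen expr1 scaleN1r -!tgen_basis linearB /=.
(* The term with the image of [a] on the left meets the overlap written in I (x) U, the term with
   the image of [b] on the right meets it in U (x) I; the Leibniz sign is the one in [overlap2]. *)
rewrite fdotBl {2}pp' !linear_sum -sumrB; apply: eq_bigr => c _ /=.
rewrite linearB /= !pairing_tgen -tgen_basis.
rewrite fdot_dualMr ?relI_val_fdegree // fdot_dualMl ?relI_val_fdegree //.
by rewrite -!delta_phi.
Qed.

End Overlap.

Section Curved.
Variable delta : 'I_(\dim {:dual U}) -> T'.
Hypothesis delta2 : forall a, delta a \in fdegree 2.
Hypothesis delta_phi : forall (a : 'I_(\dim {:dual U})) (q : relI_space f),
  e'`_a (phi q) = pairing (delta a) (relI_val q).
Variable eta : T'.
Hypothesis eta2 : eta \in fdegree 2.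
Hypothesis eta_hI : forall q : relI_space f, hI q = pairing eta (relI_val q).

(** A form of [qideal_perp3] with families in [relI_space f], where [phi] and [hI] are defined. *)
Lemma relI_perp3 (ga : T') : ga \in fdegree 3 ->
  (forall p p' : 'I_(\dim {:U}) -> relI_space f,
     \sum_c relI_val (p c) * fword [:: c]
       = \sum_c fword [:: c] * relI_val (p' c) ->
     fdot (dual_tensor ga) (\sum_c relI_val (p c) * fword [:: c]) = 0) ->
  ga \in qideal (perp (relI f)).
Proof.
move=> ga3 H; apply: qideal_perp3 => //; first exact: relI_submod.
  exact: relI_fdegree.
move=> p p' pI p'I.
exact: (H (fun c => RelI (pI c)) (fun c => RelI (p'I c))).
Qed.

(** The value on an overlap is the pairing of [be] with [overlap2], which lies in I and is therefore
    annihilated by [be]. *)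
Lemma sder_perp (be : T') : be \in perp (relI f) ->
  sder delta be \in qideal (perp (relI f)).
Proof.
move=> /perpP[be2 beI]; apply: relI_perp3 => [|p p' pp'].
  exact: sder_fdegree.
rewrite (fdot_sder_overlap pp' delta2 delta_phi be2).
by have [q [-> _ _]] := overlapP pp'; apply: beI; exact: valP.
Qed.

(** The value on an overlap is [hI q] for the relation [q] of [overlapP], which is zero; in B this
    becomes d h = 0. *)
Lemma sder_curv :
  sder delta eta \in qideal (perp (relI f)).
Proof.
apply: relI_perp3 => [|p p' pp']; first exact: sder_fdegree.
rewrite (fdot_sder_overlap pp' delta2 delta_phi eta2).
by have [q [-> _ <-]] := overlapP pp'.
Qed.

Lemma sder_sqr_gen a : sder delta (delta a)
  - (eta * fword [:: a] - fword [:: a] * eta) \in qideal (perp (relI f)).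
Proof.
have a1 : (fword [:: a] : T') \in fdegree 1 by exact: fword_fdegree.
apply: relI_perp3 => [|p p' pp'].
  rewrite -scaleN1r addrC; apply: fdegreeP_lin; last exact: sder_fdegree.
  rewrite -scaleN1r addrC; apply: fdegreeP_lin; first exact: (@fdegreeM _ _ 1 2).
  exact: (@fdegreeM _ _ 2 1).
rewrite linearB /= fdotBl (fdot_sder_overlap pp' delta2 delta_phi (delta2 a)).
(* The square contributes the value of the form [a] at [phi q], that is, at [overlap1]. The
   commutator contributes the same: [eta] pairs with [p c] when on the left and with [p' c] when on
   the right. *)
have [q [-> o1 _]] := overlapP pp'; rewrite -delta_phi -o1.
rewrite linearB /= fdotBl {2}pp' !linear_sum -!sumrB big1 // => c _ /=.
rewrite -!tgen_basis fdot_dualMr ?relI_val_fdegree //.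
rewrite fdot_dualMl ?relI_val_fdegree // -!eta_hI linearZ /=.
by rewrite /GRing.scale /=; ring.
Qed.

Theorem dualB_CDG (d1 : {linear dual U -> dualB f}) :
  (forall a : 'I_(\dim {:dual U}), d1 e'`_a = qproj (perp (relI f)) (delta a)) ->
  exists d : dualB f -> dualB f,
    (forall al : dual U, d (dualB_gen f al) = d1 al)
    /\ is_CDG (dualB_gr f) d (qproj (perp (relI f)) eta).
Proof.
move=> d1E.
have deltaI be : be \in perp (relI f) -> be \in fdegree 2 ->
    sder delta be \in qideal (perp (relI f)) by move=> beI _; exact: sder_perp.
exists (qsder (S := perp (relI f)) delta); split=> [al|].
  rewrite [LHS](qsder_proj deltaI) [in RHS](coord_vbasis (memvf al)).
  have -> : sder delta (tgen al)
      = \sum_(a < \dim {:dual U}) coord e' a al *: delta a.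
    rewrite /tgen [LHS]linear_sum; apply: eq_bigr => a _ /=.
    by rewrite linearZ /= sder_gen.
  rewrite [LHS]linear_sum [RHS]linear_sum; apply: eq_bigr => a _ /=.
  by rewrite [LHS]linearZ [RHS]linearZ /= d1E.
split.
- exact: qgr_is_graded.
- exact: (qsder_is_derivation1 delta2 deltaI).
- exact: qproj_qgr.
(* The exponent 2n is even, so the supercommutator with h is the plain commutator. *)
- move=> n x _; rewrite /supercomm mul2n -signr_odd odd_double expr0 mul1r.
  exact: (qsder_curv delta2 deltaI sder_sqr_gen).
rewrite [LHS](qsder_proj deltaI); apply/eqP; rewrite qproj_eq0.
exact: sder_curv.
Qed.

End Curved.
End CurvedDifferential.

Theorem mainTheorem1 (k : fieldType) (A : algType k) (W : vectType k)
    (j : {linear W -> A}) (e : W) (AW : weak_QLS j e)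
    (V : {vspace W}) (Ve : hyperplane_compl V e)
    (phi : {linear relI_space (incl j V) -> subvs_of V})
    (hI : {scalar relI_space (incl j V)})
    (phi_hI : forall x : tensor k (subvs_of V),
       x \in relJ2 (incl j V) <->
       exists p : relI_space (incl j V),
         x = relI_val p + tgen (phi p) + (hI p)%:A)
    (d1 : {linear dual (subvs_of V) -> dualB (incl j V)})
    (d1_phi : forall alpha : dual (subvs_of V),
       dualB2_rep (d1 alpha) (fun p => alpha (phi p)))
    (h : dualB (incl j V)) (h_hI : dualB2_rep h hI) :
  exists d : dualB (incl j V) -> dualB (incl j V),
    (forall alpha : dual (subvs_of V), d (dualB_gen (incl j V) alpha) = d1 alpha)
    /\ is_CDG (dualB_gr (incl j V)) d h.
Proof.
have [eta [eta2 -> eta_hI]] := h_hI.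
(* For each form of the chosen basis, a degree 2 tensor representing its image under [d1] is
   selected; these tensors prescribe the derivation on generators. *)
pose D (a : 'I_(\dim {:dual (subvs_of V)})) :=
  cid (d1_phi (vbasis {:dual (subvs_of V)})`_a).
apply: (@dualB_CDG _ _ _ _ phi hI phi_hI (fun a => sval (D a))) => // a;
  by case: (D a) => be [].
Qed.
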